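(* For every integer threshold $t\ge1$ there is a constant $c_t$ such that, for every adaptive FMM octree with $N$ particles in $[0,1]^3$ and subdividing threshold $t$, the number of P2P operations is at most $c_tN$; that is, the number of P2P operations is $\mathcal{O}(N)$ for a given threshold $t$.
   Context: **Adaptive octree.** Given particles $x_1,\dots,x_N\in[0,1]^3$ and an integer threshold $t\ge1$, the root corresponds to the closed cube $[0,1]^3$. A node containing more than $t$ particles is subdivided into its $8$ congruent closed sub-cubes; only children containing particles are kept as nodes. A node with at most $t$ particles is a leaf. A particle lying on a dividing midplane is assigned to the left (lower-coordinate) child, so each particle in a node belongs to exactly one child. The resulting tree is assumed finite (automatic if the particles are distinct). $\mathcal{I}(M)$ denotes the closed cube of node $M$. **P2P operations.** Nodes $A,B$ are adjacent if $\mathcal{I}(A)\cap\mathcal{I}(B)\ne\emptyset$. For a leaf $C$, U-List$(C)$ is the set of all leaves adjacent to $C$, including $C$ itself. P2P is the direct particle-to-particle interaction between $C$ and the leaves of U-List$(C)$. The number of P2P operations is $\sum_{C\text{ leaf}}\ \sum_{\alpha\in\text{U-List}(C)} n(C)\,n(\alpha)$, where $n(\cdot)$ is the number of particles in a leaf. *)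

(* Defs.v *)
From HB Require Import structures.
From mathcomp Require Import all_boot all_order all_algebra.
From mathcomp Require Import all_classical all_reals.

Set Implicit Arguments.
Unset Strict Implicit.
Unset Printing Implicit Defensive.
Import Order.TTheory GRing.Theory Num.Theory.

Local Open Scope classical_set_scope.
Local Open Scope ring_scope.

(* One of the 8 children of a cube: [d k = true] is the upper half along the
   [k]-th coordinate, [d k = false] the lower half. *)
Notation octant := {ffun 'I_3 -> bool}.

(* A cell of the dyadic subdivision of the unit cube is addressed by the path
   leading to it from the root [::], listed from the deepest octant to the
   shallowest: the child of [A] in octant [d] is [d :: A]. *)
Notation cell := (seq octant).

Definition side (R : realType) (A : cell) : R := 2%:R ^- size A.

(* The lower endpoint of the cell along the [k]-th coordinate. *)
Fixpoint corner (R : realType) (A : cell) (k : 'I_3) : R :=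
  if A is d :: B then corner R B k + (if d k then side R B / 2%:R else 0)
  else 0.

Definition midplane (R : realType) (A : cell) (k : 'I_3) : R :=
  corner R A k + side R A / 2%:R.

Definition cube (R : realType) (A : cell) : set 'rV[R]_3 :=
  [set y | forall k, corner R A k <= y ord0 k <= corner R A k + side R A].
Arguments cube : clear implicits.

(* The particles (indices) assigned to a cell.  The inequality is strict, so a
   particle lying on a dividing midplane goes to the lower child. *)
Fixpoint particles (R : realType) (N : nat) (x : 'I_N -> 'rV[R]_3) (A : cell)
    : {set 'I_N} :=
  if A is d :: B then
    [set i in particles x B | [forall k, d k == (midplane R B k < x i ord0 k)]]
  else [set: 'I_N].

Definition nparticles (R : realType) (N : nat) (x : 'I_N -> 'rV[R]_3)
  (A : cell) : nat := #|particles x A|.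

Inductive octree (R : realType) (N : nat) (t : nat) (x : 'I_N -> 'rV[R]_3)
    : set cell :=
| octree_root : octree t x [::]
| octree_child (A : cell) (d : octant) :
    octree t x A -> (t < nparticles x A)%N ->
    (0 < nparticles x (d :: A))%N -> octree t x (d :: A).

Definition leaves (R : realType) (N : nat) (t : nat) (x : 'I_N -> 'rV[R]_3)
  : set cell := [set A | octree t x A /\ (nparticles x A <= t)%N].

Definition adjacent (R : realType) (A B : cell) : Prop :=
  cube R A `&` cube R B !=set0.

(* A leaf belongs to its own U-list, since cubes are nonempty. *)
Definition u_list (R : realType) (N : nat) (t : nat) (x : 'I_N -> 'rV[R]_3)
  (C : cell) : set cell := [set A | leaves t x A /\ adjacent R C A].

(* [\sum_(_ \in _)] is the sum over the set as soon as it has finitely many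
   nonzero terms (otherwise it is 0), hence in particular for a finite tree. *)
Definition p2p_operations (R : realType) (N : nat) (t : nat)
    (x : 'I_N -> 'rV[R]_3) : nat :=
  \sum_(C \in leaves t x) \sum_(A \in u_list t x C)
    (nparticles x C * nparticles x A)%N.

(* Main.v *)
(* Charge the interaction of two adjacent leaves to the deeper one [C]: the
   other leaf is a cell at most as deep as [C] that touches it, hence contains
   one of the 27 cells of the grid of [C] surrounding [C].  Distinct leaves
   are not nested, so they contain distinct such cells, and [C] is charged at
   most 27 times.  Each charge costs at most [t] per particle of [C], and the
   leaves have disjoint sets of particles; counting both orders of a pair gives
   the constant [54 t]. *)
Require Import Defs.
From mathcomp Require Import all_boot all_order all_algebra.
From mathcomp Require Import all_classical all_reals.
From mathcomp Require Import zify ring.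
Import Order.TTheory GRing.Theory Num.Theory.
Local Open Scope classical_set_scope.
Local Open Scope ring_scope.

Set Implicit Arguments.

(** Reads the path as a binary numeral whose lowest bit is the deepest octant: the position of the
    cell among the [2 ^ size A] slots along axis [k]. Geometry of cubes thus becomes arithmetic on
    naturals. *)
Fixpoint grid_index (A : cell) (k : 'I_3) : nat :=
  if A is d :: B then ((grid_index B k).*2 + d k)%N else 0%N.

Lemma corner_grid_index (R : realType) (A : cell) (k : 'I_3) :
  corner R A k = (grid_index A k)%:R * side R A.
Proof.
elim: A => [|d B IH] /=; first by rewrite mul0r.
have s_neq0 : (2%:R ^+ size B : R) != 0 by rewrite expf_neq0 ?pnatr_eq0.
rewrite IH /side /= exprS invfM natrD -mul2n natrM.
by case: (d k) => /=; field.
Qed.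

Lemma grid_index_drop (A : cell) (j : nat) (k : 'I_3) :
  grid_index (drop j A) k = (grid_index A k %/ 2 ^ j)%N.
Proof.
elim: A j => [|d B IH] [|j] /=; rewrite ?div0n ?expn0 ?divn1 //.
by rewrite IH expnS divnMA divn2 addnC half_bit_double.
Qed.

Lemma grid_index_inj (A B : cell) :
  size A = size B -> grid_index A =1 grid_index B -> A = B.
Proof.
elim: A B => [|d A IH] [|e B] //= [sAB] eqAB.
have eq_d : d = e.
  apply/ffunP => k; have := congr1 odd (eqAB k).
  by rewrite !oddD !odd_double; case: (d k) (e k) => [] [].
subst e; congr (_ :: _); apply: IH => // k.
by have /addIn/double_inj := eqAB k.
Qed.

Lemma adjacent_sym (R : realType) (A B : cell) :
  adjacent R A B -> adjacent R B A.
Proof. by rewrite /adjacent setIC. Qed.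

(** In units of [side R C] all endpoints are integers; a common point puts each lower endpoint at or
    below the other upper endpoint, with equality possible since cubes are closed. *)
Lemma adjacent_grid_index (R : realType) (A C : cell) (k : 'I_3) :
  (size A <= size C)%N -> adjacent R C A ->
  (grid_index A k * 2 ^ (size C - size A) <= (grid_index C k).+1)%N /\
  (grid_index C k <= (grid_index A k).+1 * 2 ^ (size C - size A))%N.
Proof.
move=> sAC [y [/(_ k)/andP[Cy yC] /(_ k)/andP[Ay yA]]].
have side_gt0 : 0 < side R C by rewrite invr_gt0 exprn_gt0.
have sideA : side R A = (2 ^ (size C - size A))%:R * side R C.
  rewrite /side; move: (subnK sAC); set r := (_ - _)%N => <-.
  by rewrite exprD natrX invfM mulrA mulfV ?mul1r // expf_neq0 ?pnatr_eq0.
have cornerS B : corner R B k + side R B = (grid_index B k).+1%:R * side R B.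
  by rewrite corner_grid_index -natr1 mulrDl mul1r.
move: (le_trans Ay yC) (le_trans Cy yA).
rewrite !cornerS !corner_grid_index sideA !mulrA -!natrM.
by rewrite !ler_pM2r // !ler_nat.
Qed.

(* For a cell [A] at most as deep as [C] and adjacent to it, this is the
   position (shifted by 1 to be nonnegative) relative to [C] of a cell of the
   same depth as [C] and contained in [A]. *)
Definition neighbour_code (C A : cell) : {ffun 'I_3 -> 'I_3} :=
  [ffun k => inord
    (if (grid_index C k < grid_index A k * 2 ^ (size C - size A))%N then 2
     else if (grid_index C k < (grid_index A k).+1 * 2 ^ (size C - size A))%N
     then 1 else 0)].

(** Index plus code, minus 1, is the coordinate of a cell in the grid of [C] lying inside [A]; the
    quotient passes to its ancestor at the depth of [A]. *)
Lemma neighbour_codeP (R : realType) (A C : cell) (k : 'I_3) :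
  (size A <= size C)%N -> adjacent R C A ->
  grid_index A k =
  ((grid_index C k + neighbour_code C A k).-1 %/ 2 ^ (size C - size A))%N.
Proof.
move=> sAC /(adjacent_grid_index k sAC) [AC CA].
have q_gt0 : (0 < 2 ^ (size C - size A))%N by rewrite expn_gt0.
rewrite ffunE inordK; last by do 2?case: ifP.
move: q_gt0 AC CA; set q := (2 ^ _)%N; set m := grid_index A k.
move=> q_gt0 AC CA; set n := (_.-1).
(* The predecessor never truncates: code 0 occurs only when the index of [C] equals [m.+1 * q],
   which is positive. *)
have /andP[le1 le2] : (m * q <= n < m.+1 * q)%N.
  by rewrite /n; case: ltnP => ?; [|case: ltnP => ?]; lia.
by apply/eqP; rewrite eqn_leq leq_divRL // le1 -ltnS ltn_divLR.
Qed.

(** Equal codes designate one cell contained in both [A] and [B], and dyadic cells sharing a subcell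
    are nested. *)
Lemma neighbour_code_drop (R : realType) (A B C : cell) :
  adjacent R C A -> adjacent R C B -> (size A <= size B <= size C)%N ->
  neighbour_code C A = neighbour_code C B -> A = drop (size B - size A) B.
Proof.
move=> adjA adjB /andP[sAB sBC] eqAB.
apply: grid_index_inj => [|k]; first by rewrite size_drop subKn.
rewrite grid_index_drop (neighbour_codeP k (leq_trans sAB sBC) adjA).
rewrite (neighbour_codeP k sBC adjB) eqAB -divnMA -expnD.
by congr (_ %/ 2 ^ _)%N; lia.
Qed.

Section Tree.
Variables (R : realType) (N t : nat) (x : 'I_N -> 'rV[R]_3).

Lemma particles_drop (j : nat) (A : cell) :
  particles x A \subset particles x (drop j A).
Proof.
elim: A j => [|d B IH] [|j] //=.
apply: fintype.subset_trans (IH j).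
by apply/fintype.subsetP => i; rewrite inE => /andP[].
Qed.

Lemma particles_inj (i : 'I_N) (A B : cell) : size A = size B ->
  i \in particles x A -> i \in particles x B -> A = B.
Proof.
elim: A B => [|d A IH] [|e B] //= [sAB].
rewrite !inE => /andP[iA /forallP dA] /andP[iB /forallP eB].
have eqAB : A = B by exact: IH.
subst B; congr (_ :: _); apply/ffunP => k.
by rewrite (eqP (dA k)) (eqP (eB k)).
Qed.

Lemma octree_drop (j : nat) (A : cell) : octree t x A ->
  (0 < j <= size A)%N -> (t < nparticles x (drop j A))%N.
Proof.
move=> tA; elim: tA j => [|B d tB IH tB' _] [|j] //= jB.
case: j jB => [|j] jB; first by rewrite drop0.
exact: IH.
Qed.

(** Every proper ancestor of a node was subdivided, so it holds more than [t] particles and is not a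
    leaf. *)
Lemma leaves_drop (A B : cell) : leaves t x A -> leaves t x B ->
  (size A <= size B)%N -> A = drop (size B - size A) B -> A = B.
Proof.
move=> [_ leA] [tB _] sAB eqA.
case: (posnP (size B - size A)) => [s0|s_gt0]; first by rewrite eqA s0 drop0.
have := octree_drop (size B - size A) tB.
by rewrite s_gt0 leq_subr -eqA ltnNge leA => /(_ isT).
Qed.

(** The ancestor of the deeper leaf at the depth of the other also holds [i], so it is that other
    leaf; leaves are not nested. *)
Lemma leaves_disjoint (i : 'I_N) (A B : cell) :
  leaves t x A -> leaves t x B ->
  i \in particles x A -> i \in particles x B -> A = B.
Proof.
wlog sAB : A B / (size A <= size B)%N => [wlogH|] lA lB iA iB.
  case: (leqP (size A) (size B)) => [|/ltnW] sAB; first exact: wlogH.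
  by apply/esym; exact: wlogH.
apply: (leaves_drop lA lB sAB); apply: (particles_inj (i := i)) => //.
  by rewrite size_drop subKn.
exact: (fintype.subsetP (particles_drop _ _)).
Qed.

Lemma sum_nparticles_leaves (L : seq cell) : uniq L ->
  (forall A, A \in L -> leaves t x A) -> (\sum_(A <- L) nparticles x A <= N)%N.
Proof.
move=> uL leafL; rewrite /nparticles.
under eq_bigr do rewrite -sum1_card big_mkcond /=.
(* With the sums exchanged, each particle contributes the number of leaves holding it, at most 1. *)
rewrite exchange_big /= -[leqRHS](card_ord N) -sum1_card leq_sum // => i _.
rewrite -big_mkcond /= sum1_count -size_filter.
have eqS : {in [seq A <- L | i \in particles x A] &, forall A B, A = B}.
  move=> A B; rewrite !mem_filter => /andP[iA AL] /andP[iB BL].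
  exact: leaves_disjoint (leafL A AL) (leafL B BL) iA iB.
have: uniq [seq A <- L | i \in particles x A] by exact: filter_uniq.
case: [seq _ <- _ | _] eqS => [|A [|B s]] //= eqS /andP[/negP[]].
by rewrite (eqS A B) ?inE ?eqxx ?orbT.
Qed.

(** [neighbour_code C] is injective on these leaves, since equal codes would nest them, and it takes
    at most [3 ^ 3] values. *)
Lemma size_shallow_neighbours (L : seq cell) (C : cell) : uniq L ->
  (forall A, A \in L ->
     [/\ leaves t x A, adjacent R C A & (size A <= size C)%N]) ->
  (size L <= 27)%N.
Proof.
move=> uL leafL; rewrite -(size_map (neighbour_code C)).
have /card_uniqP <- : uniq (map (neighbour_code C) L).
  rewrite map_inj_in_uniq // => A B AL BL.
  have [lA adjA sA] := leafL _ AL; have [lB adjB sB] := leafL _ BL.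
  case: (leqP (size A) (size B)) => [|/ltnW] sAB eqAB.
    apply: leaves_drop => //.
    by apply: neighbour_code_drop adjA adjB _ eqAB; rewrite sAB.
  apply/esym/leaves_drop => //.
  by apply: neighbour_code_drop adjB adjA _ (esym eqAB); rewrite sAB.
by rewrite (leq_trans (max_card _)) // card_ffun !card_ord.
Qed.

Lemma sum_shallow_neighbours (L : seq cell) : uniq L ->
  (forall A, A \in L -> leaves t x A) ->
  (\sum_(C <- L) \sum_(A <- L | `[< adjacent R C A >] && (size A <= size C))
     nparticles x C * nparticles x A <= 27 * t * N)%N.
Proof.
move=> uL leafL.
apply: (@leq_trans (\sum_(C <- L) 27 * t * nparticles x C)); last first.
  by rewrite -big_distrr leq_mul2l sum_nparticles_leaves ?orbT.
rewrite big_seq [leqRHS]big_seq leq_sum // => C CL.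
rewrite -big_filter.
set S := [seq _ <- _ | _].
have leafS A : A \in S ->
  [/\ leaves t x A, adjacent R C A & (size A <= size C)%N].
  by rewrite mem_filter => /andP[/andP[/asboolP ? ?] /leafL].
apply: (@leq_trans (\sum_(A <- S) nparticles x C * t)).
  rewrite big_seq [leqRHS]big_seq leq_sum // => A /leafS[[_ leA] _ _].
  by rewrite leq_mul2l leA orbT.
rewrite big_const_seq count_predT iter_addn_0 [leqRHS]mulnC -mulnA leq_mul2l.
rewrite [leqRHS]mulnC leq_mul2l.
by rewrite (@size_shallow_neighbours S C (filter_uniq _ uL) leafS) !orbT.
Qed.

End Tree.

Theorem lemma2 (R : realType) (t : nat) (ht : (1 <= t)%N) :
  exists c : R, forall (N : nat) (x : 'I_N -> 'rV[R]_3),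
    (forall (i : 'I_N) (k : 'I_3), 0 <= x i ord0 k <= 1) ->
    finite_set (octree t x) ->
    (p2p_operations t x)%:R <= c * N%:R.
Proof.
exists (54 * t)%:R => N x _ fin_tree; rewrite -natrM ler_nat.
have fin_leaves : finite_set (leaves t x).
  by apply: sub_finite_set fin_tree => A [].
pose L : seq cell := finmap.enum_fset (fset_set (leaves t x)).
have uL : uniq L by exact: finmap.fset_uniq.
have leafL A : A \in L -> leaves t x A by rewrite in_fset_set // inE.
pose nn C A := (nparticles x C * nparticles x A)%N.
have -> : p2p_operations t x =
    (\sum_(C <- L) \sum_(A <- L | `[< adjacent R C A >]) nn C A)%N.
  rewrite /p2p_operations fsbig_finite //; apply: eq_bigr => C _.
  rewrite (_ : u_list t x C = leaves t x `&` [set A | adjacent R C A]) //.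
  by rewrite fsbig_mkcondr fsbig_finite // [RHS]big_mkcond.
pose T := (\sum_(C <- L)
  \sum_(A <- L | `[< adjacent R C A >] && (size A <= size C)) nn C A)%N.
(* Adjacency and [nn] are symmetric, so swapping the two leaves of each pair preserves the sum. *)
have T_sym : T = (\sum_(C <- L)
    \sum_(A <- L | `[< adjacent R C A >] && (size C <= size A)) nn C A)%N.
  rewrite /T; under eq_bigr do rewrite big_mkcond.
  rewrite exchange_big; apply: eq_bigr => A _; rewrite -big_mkcond.
  apply: eq_big => [C|C _]; last by rewrite /nn mulnC.
  by congr (_ && _); apply: asbool_equiv_eq; split; exact: adjacent_sym.
have leT : (T <= 27 * t * N)%N by exact: sum_shallow_neighbours.
(* Every ordered adjacent pair is counted in [T] or in its swapped form; pairs of equal depth are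
   counted in both, hence only an inequality. *)
apply: (@leq_trans (T + T)); last by lia.
rewrite {2}T_sym -big_split leq_sum // => C _.
rewrite [leqLHS]big_mkcond !(big_mkcond (fun A => _ && _)) -big_split.
apply: leq_sum => A _; case: `[< _ >] => //=.
by case: (leqP (size A) (size C)) => [_|/ltnW ->]; rewrite ?leq_addr ?leq_addl.
Qed.
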